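(* Let $t\geq 2$ be an integer. Put $b=t^2$ and $d=b-1=t^2-1$. Then there exists a Type 1 triangle $T_1(2,b,d)$; that is, $b\geq 3$, $2\leq d\leq b-1$, and there is a Pythagorean triangle with one leg of length $d^2$ and hypotenuse of length $d_{2,b}=d(b+1)$.
   Context: A Pythagorean triangle is a right triangle all of whose side lengths are positive integers. For integers $b\geq 3$, $2\leq d\leq b-1$ and $k\geq 2$, $d_{k,b}=d\,(b^{k-1}+\cdots+b+1)=\dfrac{d(b^k-1)}{b-1}$ denotes the positive integer whose base $b$ representation consists of $k$ digits all equal to $d$. A Pythagorean triangle is a Type 1 triangle with base $b$ repeated digits, denoted $T_1(k,b,d)$ (with $b\geq 3$, $2\leq d\leq b-1$, $k\geq 2$), if one of its two legs has length $d^k$ and its hypotenuse has length $d_{k,b}$. *)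

(* Defs.v *)
From mathcomp Require Import all_boot.

Set Implicit Arguments.
Unset Strict Implicit.
Unset Printing Implicit Defensive.

(* A triangle is given by its side lengths, up to congruence: legs x and y,
   hypotenuse z. *)
Definition pythagorean_triangle (x y z : nat) : Prop :=
  [/\ 0 < x, 0 < y, 0 < z & x ^ 2 + y ^ 2 = z ^ 2].

(* d_{k,b} = d (b^(k-1) + ... + b + 1) *)
Definition repdigit (k b d : nat) : nat := d * \sum_(i < k) b ^ i.

(* The sides x, y, z form a triangle T_1(k,b,d). The truncated b - 1 is the
   true difference, since 3 <= b. *)
Definition type1_triangle (k b d x y z : nat) : Prop :=
  [/\ 3 <= b, 2 <= d <= b - 1 & 2 <= k] /\
  [/\ pythagorean_triangle x y z,
      x = d ^ k \/ y = d ^ k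
    & z = repdigit k b d].

(* Main.v *)
Require Import Defs.
From mathcomp Require Import all_boot.

(** For b = t^2 and d = b - 1, the other leg is 2td.  Divided by d, the sides
    d^2, 2td, d(b + 1) become t^2 - 1, 2t, t^2 + 1, Euclid's Pythagorean triple
    with parameters t and 1, so the Pythagorean equation is d^2 times
    (b - 1)^2 + 4b = (b + 1)^2, an instance of [sqrnD_sub]. *)
Theorem mainTheorem10 (t b d : nat) (ht : 2 <= t) (hb : b = t ^ 2)
    (hd : d = b - 1) :
  exists x y z : nat, type1_triangle 2 b d x y z.
Proof.
have b_ge4 : 4 <= b by rewrite hb (leq_exp2r 2 t (isT : 0 < 2)).
have d_ge3 : 3 <= d by rewrite hd leq_subRL // (leq_trans _ b_ge4).
have d_gt0 : 0 < d by apply: leq_trans d_ge3.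
have t_gt0 : 0 < t by apply: leq_trans ht.
exists (d ^ 2), (2 * t * d), (d * (b + 1)); split; split.
- exact: leq_trans b_ge4.
- by rewrite -hd leqnn andbT (leq_trans _ d_ge3).
- by [].
- split; rewrite ?expn_gt0 ?muln_gt0 ?addn_gt0 ?d_gt0 ?t_gt0 ?orbT //.
  have sq_sum : (b + 1) ^ 2 = d ^ 2 + 4 * b.
    by rewrite hd -[b in 4 * b]muln1 -sqrnD_sub ?subnK ?(leq_trans _ b_ge4) ?nat_AGM2.
  by rewrite !expnMn -hb sq_sum mulnDr [4 * b * _]mulnC -mulnn.
- by left.
- by rewrite /repdigit !big_ord_recr big_ord0 /= expn0 expn1 add0n addnC.
Qed.
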